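(* Let $\gamma>0$, $\epsilon>0$ and $\Omega\in\mathbb{R}$ with $\Omega<-2\gamma$. There exist $\delta_0>0$ and $C_0>0$ such that for every initial data $(A^{(0)},B^{(0)})\in\ell^2(\mathbb{Z})\times\ell^2(\mathbb{Z})$ satisfying $$\delta:=\|A^{(0)}\|_{\ell^2}^2+\|B^{(0)}\|_{\ell^2}^2\le\delta_0,$$ the unique solution $(A,B)\in C^1(\mathbb{R},\ell^2(\mathbb{Z})\times\ell^2(\mathbb{Z}))$ of the coupled system $$\left\{\begin{array}{l} i\,\frac{dA_n}{d\tau}=\epsilon(A_{n+1}-2A_n+A_{n-1})+\Omega A_n+\gamma(\bar B_n-\bar A_n)+\frac12|A_n|^2A_n,\\ i\,\frac{dB_n}{d\tau}=\epsilon(B_{n+1}-2B_n+B_{n-1})+\Omega B_n+\gamma(\bar A_n-\bar B_n)+\frac12|B_n|^2B_n,\end{array}\right.\qquad n\in\mathbb{Z},$$ with $(A,B)(0)=(A^{(0)},B^{(0)})$ satisfies $$\|A(\tau)\|_{\ell^2}^2+\|B(\tau)\|_{\ell^2}^2\le C_0\,\delta\qquad\text{for every }\tau\in\mathbb{R}.$$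
   Context: Here $\ell^2(\mathbb{Z})$ is the space of square-summable complex sequences $A=(A_n)_{n\in\mathbb{Z}}$ with norm $\|A\|_{\ell^2}^2=\sum_{n\in\mathbb{Z}}|A_n|^2$; the bar denotes complex conjugation. Time $\tau$ is real and $C^1(\mathbb{R},X)$ denotes continuously differentiable functions of $\tau$ with values in the Banach space $X$ (regarded as a real Banach space, since the system is not complex-linear). The Cauchy problem for the system is globally well posed: for every initial data in $\ell^2(\mathbb{Z})\times\ell^2(\mathbb{Z})$ there is a unique solution in $C^1(\mathbb{R},\ell^2(\mathbb{Z})\times\ell^2(\mathbb{Z}))$. The constants $\delta_0,C_0$ may depend on $\Omega,\gamma,\epsilon$ but not on the initial data. *)

(* Defs.v *)
From HB Require Import structures.
From mathcomp Require Import all_boot all_order all_algebra.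
From mathcomp Require Import complex.
From mathcomp Require Import all_classical all_reals all_analysis.
From mathcomp Require Import ring lra.

Set Implicit Arguments.
Unset Strict Implicit.
Unset Printing Implicit Defensive.

Import Order.TTheory GRing.Theory Num.Theory.
Import numFieldNormedType.Exports.

Local Open Scope classical_set_scope.
Local Open Scope ring_scope.

(* [Rcomplex R] is [R[i]] as a real normed vector space, so that the norm of
   its elements is [R]-valued. *)
Section SquareSums.
Context {R : realType}.
Implicit Types A B : int -> Rcomplex R.

Definition sqsum A : \bar R := (\esum_(n in [set: int]) (`|A n| ^+ 2)%:E)%E.

Lemma sqsum_ge0 A : (0 <= sqsum A)%E.
Proof. by apply: esum_ge0 => n _; rewrite lee_fin sqr_ge0. Qed.

Lemma normrZ_Rcomplex (a : R) (z : Rcomplex R) : `|a *: z| = `|a| * `|z|.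
Proof.
case: z => x y.
rewrite -[LHS]/(Num.sqrt ((a * x) ^+ 2 + (a * y) ^+ 2)).
rewrite -[X in _ = _ * X]/(Num.sqrt (x ^+ 2 + y ^+ 2)).
by rewrite -(sqrtr_sqr a) -sqrtrM ?sqr_ge0// mulrDr -!exprMn.
Qed.

Lemma esumZl (a : R) (f : int -> \bar R) : 0 <= a -> (forall n, (0 <= f n)%E) ->
  (\esum_(n in [set: int]) (a%:E * f n) =
   a%:E * \esum_(n in [set: int]) f n)%E.
Proof.
move=> a0 f0; have le (b : R) (g : int -> \bar R) : 0 <= b -> (forall n, (0 <= g n)%E) ->
    (\esum_(n in [set: int]) (b%:E * g n) <=
     b%:E * \esum_(n in [set: int]) g n)%E.
  move=> b0 g0; rewrite ge_ereal_sup//= => _ [X [finX _] <-].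
  rewrite -ge0_mule_fsumr//.
  apply: lee_wpmul2l; rewrite ?lee_fin//.
  by apply: esum_ge; exists X => //; split.
move: a0; rewrite le_eqVlt => /predU1P[<-|a0].
  rewrite mul0e; apply: esum1 => n _; by rewrite mul0e.
apply/eqP; rewrite eq_le le ?(ltW a0)//=.
rewrite -[leLHS]/(a%:E * _)%E -lee_pdivlMl// .
apply: le_trans (le a^-1 (fun n => a%:E * f n)%E _ _).
- by apply: le_esum => n _; rewrite muleA -EFinM mulVf ?gt_eqF// mul1e.
- by rewrite invr_ge0 ltW.
- by move=> n; rewrite mule_ge0// lee_fin ltW.
Qed.

Lemma sqsumZ (a : R) A : sqsum (a *: A) = ((a ^+ 2)%:E * sqsum A)%E.
Proof.
have A0 n : (0 <= (`|A n| ^+ 2)%:E)%E by rewrite lee_fin sqr_ge0.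
rewrite /sqsum -esumZl ?sqr_ge0//.
apply: eq_esum => n _.
by rewrite -EFinM -[(a *: A) n]/(a *: A n) normrZ_Rcomplex exprMn real_normK ?num_real.
Qed.

Lemma sqsumD_le (t : R) A B : 0 < t ->
  (sqsum (A + B)%R <= (1 + t)%:E * sqsum A + (1 + t^-1)%:E * sqsum B)%E.
Proof.
move=> t0; have t'0 : 0 < t^-1 by rewrite invr_gt0.
have p1 : 0 <= 1 + t by lra.
have p2 : 0 <= 1 + t^-1 by lra.
have sq0 (C : int -> Rcomplex R) n : (0 <= (`|C n| ^+ 2)%:E)%E.
  by rewrite lee_fin sqr_ge0.
rewrite /sqsum -!esumZl// -esumD; do ?[by move=> n _; rewrite mule_ge0].
apply: le_esum => n _; rewrite -!EFinM -EFinD lee_fin -[(A + B) n]/(A n + B n).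
have := ler_normD (A n) (B n); have := normr_ge0 (A n + B n).
set x := `|A n|; set y := `|B n|; set z := `|_ + _| => z0 zxy.
apply: (@le_trans _ _ ((x + y) ^+ 2)).
  by rewrite ler_pXn2r// ?nnegrE// (le_trans z0).
rewrite -subr_ge0.
have -> : (1 + t) * x ^+ 2 + (1 + t^-1) * y ^+ 2 - (x + y) ^+ 2 =
          t^-1 * (t * x - y) ^+ 2 by field; rewrite gt_eqF.
by rewrite mulr_ge0 ?sqr_ge0// ltW.
Qed.

Definition square_summable : {pred int -> Rcomplex R} :=
  fun A => (sqsum A < +oo)%E.

Lemma square_summable_submod_closed : submod_closed square_summable.
Proof.
split=> [|a A B hA hB].
  rewrite unfold_in /sqsum esum1 ?ltry// => n _.
  by rewrite normr0 expr0n.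
rewrite !unfold_in in hA hB *.
apply: le_lt_trans (sqsumD_le _ _ ltr01) _.
by rewrite lte_add_pinfty// lte_mul_pinfty ?lee_fin ?invr1 ?addr_ge0//
  sqsumZ lte_mul_pinfty ?lee_fin ?sqr_ge0.
Qed.

HB.instance Definition _ :=
  GRing.isSubmodClosed.Build R (int -> Rcomplex R) square_summable
    square_summable_submod_closed.

End SquareSums.

Section Ell2.
Variable R : realType.

Record ell2 := Ell2 {
  ell2_val :> int -> Rcomplex R;
  ell2P : ell2_val \in square_summable }.

HB.instance Definition _ := [isSub for ell2_val].
HB.instance Definition _ := [Choice of ell2 by <:].
HB.instance Definition _ := [SubChoice_isSubLmodule of ell2 by <:].

Implicit Types A B : ell2.

Definition ell2_norm A : R := Num.sqrt (fine (sqsum A)).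

Lemma ell2_normE A : ((ell2_norm A) ^+ 2)%:E = sqsum A.
Proof.
have A0 := sqsum_ge0 A.
rewrite /ell2_norm sqr_sqrtr ?fine_ge0// fineK// ge0_fin_numE//.
exact: ell2P.
Qed.

Lemma ell2_norm_ge0 A : 0 <= ell2_norm A.
Proof. exact: sqrtr_ge0. Qed.

Lemma ell2_norm0_eq0 A : ell2_norm A = 0 -> A = 0.
Proof.
move=> A0; apply/val_inj/funext => n /=.
have : ((`|A n| ^+ 2)%:E <= sqsum A)%E.
  apply: esum_ge; exists [set n]; first by split.
  by rewrite fsbig_set1.
rewrite -ell2_normE A0 expr0n/= lee_fin => h.
apply/eqP; rewrite -normr_eq0 -sqrf_eq0.
by rewrite eq_le h sqr_ge0.
Qed.

Lemma ell2_normZ (a : R) A : ell2_norm (a *: A) = `|a| * ell2_norm A.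
Proof.
apply: (@pexpIrn _ 2) => //; rewrite ?nnegrE ?mulr_ge0 ?ell2_norm_ge0//.
apply: EFin_inj.
by rewrite ell2_normE exprMn EFinM ell2_normE sqsumZ real_normK ?num_real.
Qed.

Lemma ell2_norm_triangle A B :
  ell2_norm (A + B) <= ell2_norm A + ell2_norm B.
Proof.
have := ell2_norm_ge0 A; rewrite le_eqVlt => /predU1P[/esym A0|A0].
  by rewrite A0 (ell2_norm0_eq0 A0) !add0r.
have := ell2_norm_ge0 B; rewrite le_eqVlt => /predU1P[/esym B0|B0].
  by rewrite B0 (ell2_norm0_eq0 B0) !addr0.
rewrite -(@ler_pXn2r _ 2)// ?nnegrE ?addr_ge0 ?ell2_norm_ge0//.
rewrite -lee_fin ell2_normE.
apply: le_trans (@sqsumD_le _ (ell2_norm B / ell2_norm A) _ _ _) _.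
  exact: divr_gt0.
rewrite -!ell2_normE -!EFinM -EFinD lee_fin le_eqVlt; apply/orP; left.
by apply/eqP; field; rewrite !gt_eqF.
Qed.

HB.instance Definition _ := Lmodule_isNormed.Build R ell2
  ell2_norm_triangle ell2_normZ ell2_norm0_eq0.

End Ell2.

(* Continuously differentiable curves in a real normed space; the derivative
   is the limit of difference quotients in the norm of [V]. *)
Definition C1 {R : realType} {V : normedModType R} (u : R -> V) : Prop :=
  (forall t, derivable u t 1) /\ continuous (derive1 u).

Local Open Scope complex_scope.

Section System.
Context {R : realType} (epsilon Omega gamma : R).

(* Right-hand side, at site [n], of the equation for the component [A]; the
   system being symmetric, the equation for [B] exchanges [A] and [B]. *)
Definition lattice_rhs (A B : int -> R[i]) (n : int) : R[i] :=
  epsilon%:C * (A (n + 1) - 2 * A n + A (n - 1)) + Omega%:C * A n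
  + gamma%:C * (conjc (B n) - conjc (A n)) + 2^-1 * `|A n| ^+ 2 * A n.

Definition solves_system (u : R -> ell2 R * ell2 R) : Prop :=
  forall (t : R) (n : int),
    'i%C * (derive1 u t).1 n = lattice_rhs (u t).1 (u t).2 n /\
    'i%C * (derive1 u t).2 n = lattice_rhs (u t).2 (u t).1 n.

End System.

(* Main.v *)
(** With N = |A|^2 + |B|^2, c = - Omega - 2 gamma > 0 and
    K = - Omega + 2 gamma + 4 epsilon, the conserved energy
      E = sum_n [- Omega (|A_n|^2 + |B_n|^2) - (|A_n|^4 + |B_n|^4) / 4
                 + epsilon (|A_{n+1} - A_n|^2 + |B_{n+1} - B_n|^2)
                 + gamma Re (A_n - B_n)^2]
    satisfies (c - N / 4) N <= E <= K N. Hence (c - N / 4) N <= K delta at all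
    times. If K delta < c^2, the continuous function N never takes the value 2 c,
    so it stays below it, and then (c / 2) N <= K delta.

    The conservation of E is only needed as an inequality, which follows from
    the local conservation law e_n' = F_{n+1} - F_n of the energy density, with
    F_n = 2 epsilon Re (A_n' conj (A_n - A_{n-1}) + B_n' conj (B_n - B_{n-1})),
    the fluxes F_n being summable uniformly on bounded time intervals. *)

Require Import Defs.
From mathcomp Require Import all_boot all_order all_algebra.
From mathcomp Require Import complex.
From mathcomp Require Import all_classical all_reals all_analysis.
From mathcomp Require Import ring lra.

Import Order.TTheory GRing.Theory Num.Theory.
Import numFieldNormedType.Exports.

Local Open Scope ring_scope.

(** * Finite boxes exhausting the integers, and sums over them *)

(** The interval from -m to m - 1, since [Negz k] is -(k + 1). Being half-open, it makes a
    telescoping sum end exactly at m and -m. *)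
Definition box (m : nat) : seq int := map Posz (iota 0 m) ++ map Negz (iota 0 m).

Lemma mem_box m (n : int) :
  (n \in box m) = match n with Posz k | Negz k => (k < m)%N end.
Proof.
rewrite mem_cat; case: n => k.
  rewrite mem_map => [|? ? []//]; rewrite mem_iota add0n leq0n /=.
  by case: (_ < _)%N => //=; apply/negP => /mapP[].
rewrite [X in _ || X]mem_map => [|? ? []//].
rewrite mem_iota add0n leq0n /= orbC.
by case: (_ < _)%N => //=; apply/negP => /mapP[].
Qed.

Lemma subset_box m m' : (m <= m')%N -> {subset box m <= box m'}.
Proof. by move=> mm' [] k; rewrite !mem_box => /leq_trans; exact. Qed.

Lemma seq_subset_box (s : seq int) : exists m, {subset s <= box m}.
Proof.
elim: s => [|a s [m sm]]; first by exists 0%N.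
exists (maxn m (absz a).+1) => n; rewrite inE => /predU1P[->|].
  by rewrite mem_box; case: a => k /=; rewrite leq_max; apply/orP; right.
by move=> /sm; apply: subset_box; exact: leq_maxl.
Qed.

Lemma sum_le_ell2_norm (R : realType) (A : ell2 R) (s : seq int) : uniq s ->
  \sum_(n <- s) `|A n| ^+ 2 <= `|A| ^+ 2.
Proof.
move=> us; rewrite -lee_fin ell2_normE -sumEFin; apply: esum_ge.
exists [set` s]%classic; first by split => //; exact: finite_seq.
by rewrite fsbig_seq.
Qed.

Lemma sum_gt_ell2_norm (R : realType) (A : ell2 R) (r : R) : r < `|A| ^+ 2 ->
  exists s : seq int, uniq s /\ r < \sum_(n <- s) `|A n| ^+ 2.
Proof.
rewrite -lte_fin ell2_normE => /ereal_sup_gt[_ [X [finX _] <-]].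
rewrite fsbig_finite//= sumEFin lte_fin => h.
by exists (finmap.enum_fset (fset_set X)); split => //; exact: finmap.fset_uniq.
Qed.

Lemma sum_ge0_subset (R : realType) (f : int -> R) (s t : seq int) :
  (forall n, 0 <= f n) -> uniq s -> uniq t -> {subset s <= t} ->
  \sum_(n <- s) f n <= \sum_(n <- t) f n.
Proof.
move=> f0 us ut st.
rewrite [leRHS](bigID (fun n => n \in s))/=.
rewrite -[X in X + _]big_filter.
have -> : \sum_(n <- [seq n <- t | n \in s]) f n = \sum_(n <- s) f n.
  apply: perm_big; apply: uniq_perm => //; first exact: filter_uniq.
  by move=> n; rewrite mem_filter andb_idr//; exact: st.
by rewrite lerDl sumr_ge0.
Qed.

Lemma box_uniq m : uniq (box m).
Proof.
rewrite cat_uniq !map_inj_uniq ?iota_uniq ?andbT//=; try by move=> ? ? [].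
by apply/hasPn => _ /mapP[k _ ->]; apply/negP => /mapP[].
Qed.

Lemma sum_box (V : nmodType) (f : int -> V) m :
  \sum_(n <- box m) f n = \sum_(i < m) (f (Posz i) + f (Negz i)).
Proof.
rewrite big_cat !big_map big_split -(big_mkord xpredT (fun i => f (Posz i))).
by rewrite -(big_mkord xpredT (fun i => f (Negz i))) /index_iota subn0.
Qed.

Lemma sum_box_telescope (V : zmodType) (F : int -> V) m :
  \sum_(n <- box m) (F (n + 1) - F n) = F m%:Z - F (- m%:Z).
Proof.
rewrite sum_box; elim: m => [|m IH]; first by rewrite big_ord0 oppr0 subrr.
rewrite big_ord_recr /= {}IH NegzE.
have -> : m%:Z + 1 = m.+1%:Z by rewrite -addn1 PoszD.
have -> : - m.+1%:Z + 1 = - m%:Z by rewrite -addn1 PoszD opprD subrK.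
by rewrite addrACA [F m%:Z + _]addrC subrK addKr.
Qed.

(** * Real coordinates of a solution and their derivatives *)

(** A linear functional of norm at most 1 is continuous, so it passes through the limit of the
    difference quotients. *)
Lemma is_derive_linear_comp (R : realType) (V : normedModType R)
    (f : V -> R) (u : R -> V) (t : R) :
  (forall v w, f (v - w) = f v - f w) -> (forall a v, f (a *: v) = a * f v) ->
  (forall v, `|f v| <= `|v|) ->
  derivable u t 1 -> is_derive t 1 (f \o u) (f (derive1 u t)).
Proof.
move=> fB fZ fle du.
have fc : continuous f.
  move=> v; apply/cvgrPdist_le => e e0; near=> w.
  rewrite -fB; apply: le_trans (fle _) _.
  by near: w; exact: cvgr_dist_le.
have h : ((fun h : R => h^-1 *: ((f \o u \o shift t) (h *: 1) - (f \o u) t)) @ 0^'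
   --> f (derive1 u t))%classic.
  rewrite derive1E.
  have -> : (fun h : R => h^-1 *: ((f \o u \o shift t) (h *: 1) - (f \o u) t)) =
    f \o (fun h : R => h^-1 *: ((u \o shift t) (h *: 1) - u t)).
    by apply/funext => h /=; rewrite fZ fB.
  by apply: (@cvg_comp _ _ _ _ f _ _ _ du); exact: fc.
split; first by apply/cvg_ex; eexists; exact: h.
exact: (cvg_lim _ h).
Unshelve. all: by end_near. Qed.

Lemma norm_Rcomplex (R : realType) (z : Rcomplex R) :
  `|z| ^+ 2 = complex.Re z ^+ 2 + complex.Im z ^+ 2.
Proof.
case: z => a b.
by rewrite -[`|_|]/(Num.sqrt (a ^+ 2 + b ^+ 2)) sqr_sqrtr// addr_ge0 ?sqr_ge0.
Qed.

Lemma ell2_coord_le (R : realType) (A : ell2 R) n : `|A n| <= `|A|.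
Proof.
rewrite -(@ler_pXn2r _ 2)// ?nnegrE//.
by have := @sum_le_ell2_norm R A [:: n] isT; rewrite big_seq1.
Qed.

Lemma Re_le_norm (R : realType) (z : Rcomplex R) : `|complex.Re z| <= `|z|.
Proof.
rewrite -(@ler_pXn2r _ 2)// ?nnegrE// norm_Rcomplex real_normK ?num_real//.
by rewrite lerDl sqr_ge0.
Qed.

Lemma Im_le_norm (R : realType) (z : Rcomplex R) : `|complex.Im z| <= `|z|.
Proof.
rewrite -(@ler_pXn2r _ 2)// ?nnegrE// norm_Rcomplex real_normK ?num_real//.
by rewrite lerDr sqr_ge0.
Qed.

Lemma is_derive_coord (R : realType) (u : R -> ell2 R * ell2 R) (t : R) (n : int) :
  derivable u t 1 ->
  [/\ is_derive t 1 (fun s => complex.Re ((u s).1 n)) (complex.Re ((derive1 u t).1 n)),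
      is_derive t 1 (fun s => complex.Im ((u s).1 n)) (complex.Im ((derive1 u t).1 n)),
      is_derive t 1 (fun s => complex.Re ((u s).2 n)) (complex.Re ((derive1 u t).2 n)) &
      is_derive t 1 (fun s => complex.Im ((u s).2 n)) (complex.Im ((derive1 u t).2 n))].
Proof.
have n1 (v : ell2 R * ell2 R) : `|v.1| <= `|v| by rewrite [leRHS]prod_normE le_max lexx.
have n2 (v : ell2 R * ell2 R) : `|v.2| <= `|v| by rewrite [leRHS]prod_normE le_max lexx orbT.
have ReB (z w : Rcomplex R) : complex.Re (z - w) = complex.Re z - complex.Re w by case: z w => ? ? [].
have ImB (z w : Rcomplex R) : complex.Im (z - w) = complex.Im z - complex.Im w by case: z w => ? ? [].
have ReZ a (z : Rcomplex R) : complex.Re (a *: z) = a * complex.Re z by case: z.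
have ImZ a (z : Rcomplex R) : complex.Im (a *: z) = a * complex.Im z by case: z.
move=> du.
have coord (p : ell2 R * ell2 R -> ell2 R) (f : Rcomplex R -> R) :
    (forall v w, p (v - w) n = p v n - p w n) ->
    (forall a v, p (a *: v) n = a *: p v n) -> (forall v, `|p v| <= `|v|) ->
    (forall z w, f (z - w) = f z - f w) -> (forall a z, f (a *: z) = a * f z) ->
    (forall z, `|f z| <= `|z|) ->
    is_derive t 1 (fun s => f (p (u s) n)) (f (p (derive1 u t) n)).
  move=> pB pZ ple fB fZ fle.
  refine (@is_derive_linear_comp R _ (fun v => f (p v n)) u t _ _ _ du) => [v w|a v|v].
  - by rewrite pB.
  - by rewrite pZ.
  - by rewrite (le_trans (fle _))// (le_trans (ell2_coord_le _ _ n)).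
split.
- by apply: (coord fst (@complex.Re R)) => //; exact: Re_le_norm.
- by apply: (coord fst (@complex.Im R)) => //; exact: Im_le_norm.
- by apply: (coord snd (@complex.Re R)) => //; exact: Re_le_norm.
- by apply: (coord snd (@complex.Im R)) => //; exact: Im_le_norm.
Qed.

Lemma lattice_eq_ReIm (R : realType) (eps Om g : R) (A B : int -> R[i]) (z : R[i]) n :
  ('i%C * z = lattice_rhs eps Om g A B n)%R ->
  let x k := complex.Re (A k) in let y k := complex.Im (A k) in
  - complex.Im z = eps * (x (n + 1) - 2 * x n + x (n - 1)) + Om * x n
     + g * (complex.Re (B n) - x n) + 2^-1 * (x n ^+ 2 + y n ^+ 2) * x n /\
  complex.Re z = eps * (y (n + 1) - 2 * y n + y (n - 1)) + Om * y n
     - g * (complex.Im (B n) - y n) + 2^-1 * (x n ^+ 2 + y n ^+ 2) * y n.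
Proof.
rewrite /lattice_rhs -add_Re2_Im2.
have -> : (2^-1 : R[i]) = (2^-1)%:C%C by rewrite fmorphV rmorph_nat.
have -> : (2 : R[i]) = (2%:R)%:C%C by rewrite rmorph_nat.
case: z (A (n + 1)) (A (n - 1)) (A n) (B n) => a b [p p'] [q q'] [x y] [z w].
move=> [] /= h1 h2.
(* These are the real and imaginary parts of i(a + ib) as the complex product computes them. *)
split; [transitivity (0 * a - 1 * b); first by ring | transitivity (0 * b + 1 * a); first by ring].
  by rewrite h1; ring.
by rewrite h2; ring.
Qed.

(** * The energy density: bounds and local conservation law *)

Section Energy.
Context {R : realType} (eps Om g : R).
Implicit Types v dv : ell2 R * ell2 R.

Definition site_mass v (n : int) : R :=
  complex.Re (v.1 n) ^+ 2 + complex.Im (v.1 n) ^+ 2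
  + complex.Re (v.2 n) ^+ 2 + complex.Im (v.2 n) ^+ 2.

Definition mass v : R := `|v.1| ^+ 2 + `|v.2| ^+ 2.

(* Summed over [n], this is the opposite of the Hamiltonian [H] for which the
   system reads i dA_n/dtau = dH/d(conj A_n), i dB_n/dtau = dH/d(conj B_n). *)
Definition energy_density v (n : int) : R :=
  - Om * site_mass v n
  - 4^-1 * ((complex.Re (v.1 n) ^+ 2 + complex.Im (v.1 n) ^+ 2) ^+ 2
            + (complex.Re (v.2 n) ^+ 2 + complex.Im (v.2 n) ^+ 2) ^+ 2)
  + eps * ((complex.Re (v.1 (n + 1)) - complex.Re (v.1 n)) ^+ 2
           + (complex.Im (v.1 (n + 1)) - complex.Im (v.1 n)) ^+ 2
           + (complex.Re (v.2 (n + 1)) - complex.Re (v.2 n)) ^+ 2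
           + (complex.Im (v.2 (n + 1)) - complex.Im (v.2 n)) ^+ 2)
  + g * ((complex.Re (v.1 n) - complex.Re (v.2 n)) ^+ 2
         - (complex.Im (v.1 n) - complex.Im (v.2 n)) ^+ 2).

Definition energy_flux v dv (n : int) : R :=
  2 * eps *
    (complex.Re (dv.1 n) * (complex.Re (v.1 n) - complex.Re (v.1 (n - 1)))
     + complex.Im (dv.1 n) * (complex.Im (v.1 n) - complex.Im (v.1 (n - 1)))
     + complex.Re (dv.2 n) * (complex.Re (v.2 n) - complex.Re (v.2 (n - 1)))
     + complex.Im (dv.2 n) * (complex.Im (v.2 n) - complex.Im (v.2 (n - 1)))).

Lemma site_mass_ge0 v n : 0 <= site_mass v n.
Proof. by rewrite /site_mass !addr_ge0 ?sqr_ge0. Qed.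

Lemma mass_ge0 v : 0 <= mass v.
Proof. by rewrite addr_ge0 ?sqr_ge0. Qed.

Lemma site_massE v n : site_mass v n = `|v.1 n| ^+ 2 + `|v.2 n| ^+ 2.
Proof. by rewrite !norm_Rcomplex /site_mass; ring. Qed.

Lemma sum_site_mass_le v (s : seq int) : uniq s ->
  \sum_(n <- s) site_mass v n <= mass v.
Proof.
move=> us; under eq_bigr do rewrite site_massE.
by rewrite big_split lerD ?sum_le_ell2_norm.
Qed.

Lemma site_mass_le v n : site_mass v n <= mass v.
Proof. by have := @sum_site_mass_le v [:: n] isT; rewrite big_seq1. Qed.

(** The hopping term is nonnegative, the coupling is at least -2g times the site mass because (y -
    w)^2 <= 2 y^2 + 2 w^2, and the quartic sum is at most the square of the site mass, one factor of
    which is bounded by the total mass. *)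
Lemma energy_density_ge v n : 0 <= eps -> 0 <= g ->
  (- Om - 2 * g - mass v / 4) * site_mass v n
  <= energy_density v n.
Proof.
move=> e0 g0; have := site_mass_le v n; have := site_mass_ge0 v n.
rewrite /energy_density; set N := mass v.
have -> : site_mass v n = (complex.Re (v.1 n) ^+ 2 + complex.Im (v.1 n) ^+ 2)
  + (complex.Re (v.2 n) ^+ 2 + complex.Im (v.2 n) ^+ 2) by rewrite /site_mass; ring.
set x := complex.Re (v.1 n); set y := complex.Im (v.1 n).
set z := complex.Re (v.2 n); set w := complex.Im (v.2 n).
set D := (X in eps * X).
have D0 : 0 <= eps * D by rewrite mulr_ge0// !addr_ge0 ?sqr_ge0.
move=> p0 pN.
have a0 : 0 <= x ^+ 2 + y ^+ 2 by rewrite addr_ge0 ?sqr_ge0.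
have b0 : 0 <= z ^+ 2 + w ^+ 2 by rewrite addr_ge0 ?sqr_ge0.
have quartic : (x ^+ 2 + y ^+ 2) ^+ 2 + (z ^+ 2 + w ^+ 2) ^+ 2
    <= N * (x ^+ 2 + y ^+ 2 + (z ^+ 2 + w ^+ 2)).
  apply: le_trans (ler_wpM2r p0 pN); rewrite -subr_ge0.
  by have := mulr_ge0 a0 b0; nra.
have coupling : 0 <= g * ((x - z) ^+ 2 - (y - w) ^+ 2
    + 2 * (x ^+ 2 + y ^+ 2 + (z ^+ 2 + w ^+ 2))).
  apply: mulr_ge0 => //.
  by have := sqr_ge0 (x - z); have := sqr_ge0 x; have := sqr_ge0 z;
    have := sqr_ge0 (y + w); lra.
by lra.
Qed.

(** The quartic term has a favourable sign; squares of differences are bounded by twice the sum of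
    squares, whence the mass at the neighbour n + 1. *)
Lemma energy_density_le v n : 0 <= eps -> 0 <= g ->
  energy_density v n <=
  (- Om + 2 * g + 2 * eps) * site_mass v n + 2 * eps * site_mass v (n + 1).
Proof.
move=> e0 g0; rewrite /energy_density /site_mass.
set x := complex.Re (v.1 n); set y := complex.Im (v.1 n).
set z := complex.Re (v.2 n); set w := complex.Im (v.2 n).
set x1 := complex.Re (v.1 _); set y1 := complex.Im (v.1 _).
set z1 := complex.Re (v.2 _); set w1 := complex.Im (v.2 _).
have quartic : 0 <= (x ^+ 2 + y ^+ 2) ^+ 2 + (z ^+ 2 + w ^+ 2) ^+ 2.
  by rewrite addr_ge0 ?sqr_ge0.
have coupling : 0 <= g * ((x + z) ^+ 2 + 2 * y ^+ 2 + 2 * w ^+ 2 + (y - w) ^+ 2).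
  apply: mulr_ge0 => //.
  by have := sqr_ge0 (x + z); have := sqr_ge0 y; have := sqr_ge0 w;
    have := sqr_ge0 (y - w); lra.
have hopping : 0 <= eps * ((x1 + x) ^+ 2 + (y1 + y) ^+ 2 + (z1 + z) ^+ 2 + (w1 + w) ^+ 2).
  by rewrite mulr_ge0// !addr_ge0 ?sqr_ge0.
by lra.
Qed.

Lemma energy_flux_le v dv n : 0 <= eps ->
  `|energy_flux v dv n| <=
  eps * (site_mass dv n + 2 * site_mass v n + 2 * site_mass v (n - 1)).
Proof.
move=> e0.
have young (a b c : R) : `|2 * a * (b - c)| <= a ^+ 2 + 2 * b ^+ 2 + 2 * c ^+ 2.
  have := sqr_ge0 (a + (b - c)); have := sqr_ge0 (a - (b - c)).
  by have := sqr_ge0 (b + c); rewrite ler_norml => *; apply/andP; split; lra.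
have -> : energy_flux v dv n = eps * (
    2 * complex.Re (dv.1 n) * (complex.Re (v.1 n) - complex.Re (v.1 (n - 1)))
    + 2 * complex.Im (dv.1 n) * (complex.Im (v.1 n) - complex.Im (v.1 (n - 1)))
    + 2 * complex.Re (dv.2 n) * (complex.Re (v.2 n) - complex.Re (v.2 (n - 1)))
    + 2 * complex.Im (dv.2 n) * (complex.Im (v.2 n) - complex.Im (v.2 (n - 1)))).
  by rewrite /energy_flux; ring.
rewrite normrM ger0_norm// ler_wpM2l//.
apply: (le_trans (ler_normD _ _)).
apply: (le_trans (lerD (ler_normD _ _) (lexx _))).
apply: (le_trans (lerD (lerD (ler_normD _ _) (lexx _)) (lexx _))).
apply: (le_trans (lerD (lerD (lerD (young _ _ _) (young _ _ _)) (young _ _ _)) (young _ _ _))).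
by rewrite /site_mass; lra.
Qed.

(** The chain rule for the density, with the coordinates at n and n + 1 abstracted to arbitrary
    differentiable functions. *)
Lemma is_derive_density_polynomial (x y z w x1 y1 z1 w1 : R -> R)
    (x' y' z' w' x1' y1' z1' w1' t : R) :
  is_derive t 1 x x' -> is_derive t 1 y y' ->
  is_derive t 1 z z' -> is_derive t 1 w w' ->
  is_derive t 1 x1 x1' -> is_derive t 1 y1 y1' ->
  is_derive t 1 z1 z1' -> is_derive t 1 w1 w1' ->
  is_derive t 1 (fun s =>
      - Om * (x s ^+ 2 + y s ^+ 2 + z s ^+ 2 + w s ^+ 2)
      - 4^-1 * ((x s ^+ 2 + y s ^+ 2) ^+ 2 + (z s ^+ 2 + w s ^+ 2) ^+ 2)
      + eps * ((x1 s - x s) ^+ 2 + (y1 s - y s) ^+ 2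
               + (z1 s - z s) ^+ 2 + (w1 s - w s) ^+ 2)
      + g * ((x s - z s) ^+ 2 - (y s - w s) ^+ 2))
    (- (2 * Om) * (x t * x' + y t * y' + z t * z' + w t * w')
     - ((x t ^+ 2 + y t ^+ 2) * (x t * x' + y t * y')
        + (z t ^+ 2 + w t ^+ 2) * (z t * z' + w t * w'))
     + 2 * eps * ((x1 t - x t) * (x1' - x') + (y1 t - y t) * (y1' - y')
               + (z1 t - z t) * (z1' - z') + (w1 t - w t) * (w1' - w'))
     + 2 * g * ((x t - z t) * (x' - z') - (y t - w t) * (y' - w'))).
Proof.
move=> dx dy dz dw dx1 dy1 dz1 dw1.
(* The same function, up to conversion, written with operations on functions so that the
   differentiation rules apply. *)
suff : is_derive t 1
   (- Om \*: (x ^+ 2 + y ^+ 2 + z ^+ 2 + w ^+ 2)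
    - 4^-1 \*: ((x ^+ 2 + y ^+ 2) ^+ 2 + (z ^+ 2 + w ^+ 2) ^+ 2)
    + eps \*: ((x1 - x) ^+ 2 + (y1 - y) ^+ 2 + (z1 - z) ^+ 2 + (w1 - w) ^+ 2)
    + g \*: ((x - z) ^+ 2 - (y - w) ^+ 2))
    (- (2 * Om) * (x t * x' + y t * y' + z t * z' + w t * w')
     - ((x t ^+ 2 + y t ^+ 2) * (x t * x' + y t * y')
        + (z t ^+ 2 + w t ^+ 2) * (z t * z' + w t * w'))
     + 2 * eps * ((x1 t - x t) * (x1' - x') + (y1 t - y t) * (y1' - y')
               + (z1 t - z t) * (z1' - z') + (w1 t - w t) * (w1' - w'))
     + 2 * g * ((x t - z t) * (x' - z') - (y t - w t) * (y' - w'))) by [].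
have dsqr (f : R -> R) (f' : R) : is_derive t 1 f f' -> is_derive t 1 (f ^+ 2) (2 * f t * f').
  by move=> df; apply: is_derive_eq (is_deriveX 2 df) _; rewrite expr1.
have dxy := is_deriveD (dsqr _ _ dx) (dsqr _ _ dy).
have dzw := is_deriveD (dsqr _ _ dz) (dsqr _ _ dw).
have mass := is_deriveZ (- Om) (is_deriveD (is_deriveD dxy (dsqr _ _ dz)) (dsqr _ _ dw)).
have quartic := is_deriveZ 4^-1 (is_deriveD (dsqr _ _ dxy) (dsqr _ _ dzw)).
have hopping := is_deriveZ eps (is_deriveD (is_deriveD (is_deriveD
  (dsqr _ _ (is_deriveB dx1 dx)) (dsqr _ _ (is_deriveB dy1 dy)))
  (dsqr _ _ (is_deriveB dz1 dz))) (dsqr _ _ (is_deriveB dw1 dw))).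
have coupling := is_deriveZ g (is_deriveB
  (dsqr _ _ (is_deriveB dx dz)) (dsqr _ _ (is_deriveB dy dw))).
apply: is_derive_eq (is_deriveD (is_deriveD (is_deriveB mass quartic) hopping) coupling) _.
rewrite /GRing.scale /= !fctE.
by field.
Qed.

(** Subtracting the flux difference turns the hopping contribution into a discrete Laplacian at n.
    By the equations, the remainder is -2 Re (conj A_n' * i A_n') plus its analogue for B, and both
    vanish. *)
Lemma is_derive_energy_density (u : R -> ell2 R * ell2 R) (t : R) (n : int) :
  derivable u t 1 -> solves_system eps Om g u ->
  is_derive t 1 (fun s => energy_density (u s) n)
    (energy_flux (u t) (derive1 u t) (n + 1) - energy_flux (u t) (derive1 u t) n).
Proof.
move=> du sol.
have [/lattice_eq_ReIm/= [eqy eqx] /lattice_eq_ReIm/= [eqw eqz]] := sol t n.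
have [dx dy dz dw] := is_derive_coord _ u t n du.
have [dx1 dy1 dz1 dw1] := is_derive_coord _ u t (n + 1) du.
apply: is_derive_eq (is_derive_density_polynomial _ _ _ _ _ _ _ _ _ _ _ _ _ _ _ _ _
  dx dy dz dw dx1 dy1 dz1 dw1) _.
rewrite /energy_flux addrK.
set x' := complex.Re ((derive1 u t).1 n) in eqx *.
set y' := complex.Im ((derive1 u t).1 n) in eqy *.
set z' := complex.Re ((derive1 u t).2 n) in eqz *.
set w' := complex.Im ((derive1 u t).2 n) in eqw *.
have {}eqy := canRL opprK eqy; have {}eqw := canRL opprK eqw.
rewrite {}eqx {}eqy {}eqz {}eqw.
by field.
Qed.

End Energy.

(** * From local conservation to an energy inequality on the whole lattice *)

Lemma ler_dist_derive_bounded (R : realType) (f df : R -> R) (C t : R) :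
  (forall s : R, is_derive s 1 f (df s)) ->
  (forall s, `|s| <= `|t| -> `|df s| <= C) -> `|f t - f 0| <= C * `|t|.
Proof.
move=> fdf dfC.
have fc A : {within A, continuous f}%classic.
  apply: continuous_subspaceT => s.
  by apply/differentiable_continuous/derivable1_diffP; have [] := fdf s.
have [t0|t0] := leP 0 t.
  have [s + ->] := MVT_segment t0 (fun s _ => fdf s) (fc _).
  rewrite in_itv/= subr0 normrM => /andP[s0 st].
  by rewrite ler_wpM2r// dfC// !ger0_norm.
have [s + e] := MVT_segment (ltW t0) (fun s _ => fdf s) (fc _).
rewrite distrC e in_itv/= sub0r normrM normrN => /andP[ts s0].
by rewrite ler_wpM2r// dfC// !ler0_norm ?(ltW t0)// lerN2.
Qed.

Section Trapping.
Context {R : realType}.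
Implicit Types v dv : ell2 R * ell2 R.

Lemma continuous_mass (u : R -> ell2 R * ell2 R) :
  continuous u -> continuous (mass \o u).
Proof.
move=> cu t; have sq (f : R -> ell2 R) : {for t, continuous f} ->
    {for t, continuous (fun s => `|f s| ^+ 2)}.
  move=> cf; apply: (@continuous_comp _ _ _ (fun s => `|f s|) (fun x => x ^+ 2)).
    by apply: (continuous_comp cf); exact: norm_continuous.
  exact: exprn_continuous.
by apply: (@continuousD _ _ _ (fun s => `|(u s).1| ^+ 2) (fun s => `|(u s).2| ^+ 2));
  apply: sq; apply: (continuous_comp (cu t)); [exact: cvg_fst|exact: cvg_snd].
Qed.

(** Finitely many sites carry nearly all the mass; as the terms are nonnegative, every box
    containing those sites does too. *)
Lemma sum_site_mass_gt v (r : R) : r < mass v ->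
  exists m0, forall m, (m0 <= m)%N -> r < \sum_(n <- box m) site_mass v n.
Proof.
rewrite /mass => rv; pose e := (mass v - r) / 2.
have e0 : 0 < e by rewrite /e /mass; lra.
have [s1 [us1 hs1]] := @sum_gt_ell2_norm R v.1 (`|v.1| ^+ 2 - e) ltac:(lra).
have [s2 [us2 hs2]] := @sum_gt_ell2_norm R v.2 (`|v.2| ^+ 2 - e) ltac:(lra).
have [m0 hm0] := seq_subset_box (s1 ++ s2).
exists m0 => m m0m; under eq_bigr do rewrite site_massE.
rewrite big_split /=.
have sub (A : ell2 R) (s : seq int) : uniq s -> {subset s <= s1 ++ s2} ->
    \sum_(n <- s) `|A n| ^+ 2 <= \sum_(n <- box m) `|A n| ^+ 2.
  move=> us ss; apply: sum_ge0_subset => [n|//||n /ss /hm0 /(subset_box _ _ m0m)//].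
    exact: sqr_ge0.
  exact: box_uniq.
have h1 := sub v.1 s1 us1 ltac:(by move=> n ns; rewrite mem_cat ns).
have h2 := sub v.2 s2 us2 ltac:(by move=> n ns; rewrite mem_cat ns orbT).
by move: hs1 hs2 h1 h2; rewrite /e /mass; lra.
Qed.

(** The bound does not depend on [s]: translating a duplicate-free list keeps it duplicate-free, so
    the shifted masses also sum to at most the total mass. *)
Lemma sum_energy_flux_le (eps : R) v dv (s : seq int) : 0 <= eps -> uniq s ->
  \sum_(n <- s) `|energy_flux eps v dv n| <= eps * (mass dv + 4 * mass v).
Proof.
move=> eps0 us; apply: le_trans (ler_sum _ (fun n _ => energy_flux_le eps v dv n eps0)) _.
rewrite -big_distrr /= ler_wpM2l// 2!big_split /= -!big_distrr /=.
have shift : \sum_(n <- s) site_mass v (n - 1) <= mass v.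
  rewrite -(big_map (fun n => n - 1) xpredT (site_mass v)) sum_site_mass_le//.
  by rewrite map_inj_uniq//; exact: addIr.
have := sum_site_mass_le v s us; have := sum_site_mass_le dv s us.
by lra.
Qed.

Lemma sum_energy_density_le (eps Om g : R) v (s : seq int) :
  0 <= eps -> 0 <= g -> Om <= - (2 * g) -> uniq s ->
  \sum_(n <- s) energy_density eps Om g v n <=
  (- Om + 2 * g + 4 * eps) * mass v.
Proof.
move=> eps0 g0 Omg us.
apply: le_trans (ler_sum _ (fun n _ => energy_density_le eps Om g v n eps0 g0)) _.
rewrite big_split /= -!big_distrr /=.
have shift : \sum_(n <- s) site_mass v (n + 1) <= mass v.
  rewrite -(big_map (fun n => n + 1) xpredT (site_mass v)) sum_site_mass_le//.
  by rewrite map_inj_uniq//; exact: addIr.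
have k0 : 0 <= - Om + 2 * g + 2 * eps by lra.
have e0 : 0 <= 2 * eps by lra.
have := lerD (ler_wpM2l k0 (sum_site_mass_le v s us)) (ler_wpM2l e0 shift).
by lra.
Qed.

(** By contradiction: a violation at time t would give every large box more energy at time t than
    any box has at time 0, by a margin [eta] independent of the box. *)
Lemma mass_trapped (eps Om g : R) (u : R -> ell2 R * ell2 R) :
  0 <= eps -> 0 <= g -> Om <= - (2 * g) -> C1 u ->
  solves_system eps Om g u -> forall t,
  (- Om - 2 * g - mass (u t) / 4) * mass (u t)
  <= (- Om + 2 * g + 4 * eps) * mass (u 0).
Proof.
move=> eps0 g0 Omg [du cdu] sol t.
set k := - Om - _ - _; set K := _ + 4 * eps.
have K0 : 0 <= K by rewrite /K; lra.
have KN0 : 0 <= K * mass (u 0) by rewrite mulr_ge0// mass_ge0.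
have [k0|k0] := leP k 0; first by apply: le_trans KN0; exact: mulr_le0_ge0 k0 (mass_ge0 _).
rewrite leNgt; apply/negP => lt.
(* A midpoint: below the mass at time t, so large boxes exceed it, and above the threshold that
   makes [eta] positive. *)
pose r := (K * mass (u 0) / k + mass (u t)) / 2.
have lt' : K * mass (u 0) / k < mass (u t) by rewrite ltr_pdivrMr// [mass (u t) * _]mulrC.
have [m0 hm0] := @sum_site_mass_gt (u t) r ltac:(rewrite /r; lra).
pose eta := k * r - K * mass (u 0).
have eta0 : 0 < eta.
  by rewrite subr_gt0 [k * _]mulrC -ltr_pdivrMr// /r; lra.
have cu : continuous u.
  by move=> s; apply/differentiable_continuous/derivable1_diffP/du.
(* Twice the bound on the summed fluxes, one copy for each end of the boxes; its maximum over
   [-|t|, |t|] exists because the curve is C^1. *)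
pose b s := 2 * (eps * (mass (derive1 u s) + 4 * mass (u s))).
have cb : continuous b.
  move=> s; have cst a : {for s, continuous (fun=> a : R)} by exact: cst_continuous.
  exact: (continuousM (cst 2) (continuousM (cst eps) (continuousD
    (continuous_mass _ cdu s) (continuousM (cst 4) (continuous_mass _ cu s))))).
have [c _ hc] := @EVT_max R b (- `|t|) `|t|
  ltac:(have := normr_ge0 t; lra) (continuous_subspaceT cb).
(* The box [m] exchanges energy only through its two ends, so the total change
   of the energies of [M] nested boxes is bounded independently of [M]; an excess
   [eta] in each of them is then impossible. *)
pose Phi M s := \sum_(i < M) \sum_(n <- box (m0 + i)) energy_density eps Om g (u s) n.
pose dPhi M s := \sum_(i < M) (energy_flux eps (u s) (derive1 u s) (m0 + i)%:Z
   - energy_flux eps (u s) (derive1 u s) (- (m0 + i)%:Z)).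
have dPhiE M (s : R) : is_derive s 1 (Phi M) (dPhi M s).
  have -> : Phi M = \sum_(i < M) (fun s => \sum_(n <- box (m0 + i)) energy_density eps Om g (u s) n).
    by apply/funext => x; rewrite fct_sumE.
  apply: is_derive_sum => i; rewrite -sum_box_telescope.
  elim: (box (m0 + i)) => [|n l IH].
    under eq_fun do rewrite big_nil; rewrite big_nil; exact: is_derive_cst.
  under eq_fun do rewrite big_cons; rewrite big_cons.
  by apply: is_deriveD IH; exact: is_derive_energy_density.
have dPhi_le M s : `|s| <= `|t| -> `|dPhi M s| <= b c.
  move=> st; apply: (@le_trans _ _ (b s)); last by rewrite hc// in_itv/= -ler_norml.
  rewrite /dPhi sumrB; apply: le_trans (ler_normB _ _) _.
  (* The right ends of the nested boxes are distinct sites, and so are the left ends; each family of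
     fluxes is thus bounded independently of [M]. *)
  have flux (h : nat -> int) : injective h ->
      `|\sum_(i < M) energy_flux eps (u s) (derive1 u s) (h (m0 + i)%N)|
      <= eps * (mass (derive1 u s) + 4 * mass (u s)).
    move=> hinj; apply: le_trans (ler_norm_sum _ _ _) _.
    rewrite -(big_mkord xpredT (fun i => `|energy_flux eps (u s) (derive1 u s) (h (m0 + i)%N)|)).
    rewrite -(big_map (fun i => h (m0 + i)%N) xpredT (fun n => `|energy_flux eps (u s) (derive1 u s) n|)).
    apply: sum_energy_flux_le => //; rewrite map_inj_uniq ?iota_uniq// => i j /hinj /addnI//.
  rewrite /b mulr2n mulrDl mul1r; apply: lerD.
    by apply: (flux Posz) => i j [].
  by apply: (flux (fun i => - i%:Z)) => i j /oppr_inj [].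
have growth M : M%:R * eta <= b c * `|t|.
  apply: le_trans (ler_dist_derive_bounded _ _ _ _ _ (dPhiE M) (dPhi_le M)).
  apply: le_trans (ler_norm _); rewrite /Phi -sumrB.
  rewrite mulr_natl -[X in _ *+ X]card_ord -sumr_const; apply: ler_sum => i _.
  rewrite lerB//; last by apply: sum_energy_density_le => //; exact: box_uniq.
  apply: (@le_trans _ _ (k * \sum_(n <- box (m0 + i)) site_mass (u t) n)).
    by rewrite ler_wpM2l ?ltW// hm0// leq_addr.
  by rewrite big_distrr /=; apply: ler_sum => n _; exact: energy_density_ge.
(* The case M = 0 shows that the bound is nonnegative, as the Archimedean property requires; a large
   M then contradicts [growth]. *)
have := growth 0; rewrite mul0r => /(divr_ge0)/(_ (ltW eta0))/archi_boundP.
by rewrite ltr_pdivrMr// ltNge growth.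
Qed.

End Trapping.

(** * Continuity argument and choice of constants *)

Lemma continuous_avoid_lt {R : realType} (f : R -> R) (a : R) :
  continuous f -> f 0 < a -> (forall s, f s != a) -> forall t, f t < a.
Proof.
move=> cf f0a fa t; rewrite ltNge; apply/negP => aft.
have cA A : {within A, continuous f}%classic by exact: continuous_subspaceT.
have [t0|/ltW t0] := leP 0 t.
  have [|s _ /eqP] := @IVT R f 0 t a t0 (cA _); last by rewrite (negbTE (fa s)).
  by rewrite ge_min le_max (ltW f0a) aft orbT.
have [|s _ /eqP] := @IVT R f t 0 a t0 (cA _); last by rewrite (negbTE (fa s)).
by rewrite ge_min le_max (ltW f0a) aft orbT.
Qed.

Theorem theorem2 (R : realType) (gamma epsilon Omega : R)
    (gamma_gt0 : 0 < gamma) (epsilon_gt0 : 0 < epsilon)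
    (Omega_lt : Omega < - (2 * gamma)) :
  exists delta0 C0 : R, 0 < delta0 /\ 0 < C0 /\
    forall A0 B0 : ell2 R,
      let delta := `|A0| ^+ 2 + `|B0| ^+ 2 in
      delta <= delta0 ->
      forall u : R -> ell2 R * ell2 R,
        C1 u -> solves_system epsilon Omega gamma u -> u 0 = (A0, B0) ->
        forall tau : R, `|(u tau).1| ^+ 2 + `|(u tau).2| ^+ 2 <= C0 * delta.
Proof.
pose c := - Omega - 2 * gamma; pose K := - Omega + 2 * gamma + 4 * epsilon.
have c0 : 0 < c by rewrite /c; lra.
have K0 : 0 < K by rewrite /K; lra.
(* The first entry of the minimum puts the initial mass below 2c; the second gives K delta <= c^2 /
   2. The constant 2K / c comes from (c / 2) N <= K delta. *)
exists (Num.min c (c ^+ 2 / (2 * K))), (2 * K / c).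
split; first by rewrite lt_min c0 divr_gt0 ?exprn_gt0 ?mulr_gt0.
split; first by rewrite divr_gt0 ?mulr_gt0.
move=> A0 B0 delta; rewrite le_min ler_pdivlMr ?mulr_gt0// => /andP[dc dK].
move=> u C1u sol u0.
have mass0 : mass (u 0) = delta by rewrite u0.
have trapped t : (c - mass (u t) / 4) * mass (u t) <= K * delta.
  by rewrite -mass0; apply: mass_trapped => //; lra.
have cu : continuous u.
  by move=> s; apply/differentiable_continuous/derivable1_diffP/(C1u.1 s).
have lt t : mass (u t) < 2 * c.
  apply: (continuous_avoid_lt _ _ (continuous_mass _ cu)) => /= [|s].
    by rewrite mass0; lra.
  (* At mass 2c the left side of [trapped] equals c^2, beyond K delta. *)
  apply/eqP => e; have := trapped s; rewrite e.
  by have := exprn_gt0 2 c0; lra.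
move=> t; rewrite -/(mass (u t)) mulrAC ler_pdivlMr//.
(* A quarter of this product is the gap between (c - N / 4) N and (c / 2) N. *)
have : mass (u t) * (2 * c - mass (u t)) >= 0 by rewrite mulr_ge0 ?mass_ge0// subr_ge0 ltW.
by have := trapped t; lra.
Qed.
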